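(* Let $E$ be a finite set, $S=\mathbb{C}[x_e : e\in E]$, and let $I\subset S$ be an ideal that is homogeneous with respect to the standard grading and does not contain the irrelevant ideal. Let $w\in\mathbb{R}^E$ and $\Theta^*=\operatorname{subd}_{-w}\mathcal A(I)$. For each cell $\Delta$ of $\Theta^*$, let $I^\Delta=I\cap\mathbb{C}[\Delta]$, and let $\widetilde I^\Delta$ be the ideal of $S$ generated by $I^\Delta$ together with all $x_e$ such that $a_e\notin\Delta$. Set $$I^w=\bigcap_{\Delta\text{ cell of }\Theta^*}\widetilde I^\Delta .$$ Then $\operatorname{in}_w I\subseteq I^w$.
   Context: For $w\in\mathbb{R}^E$, the $w$-weight of $\prod x_e^{\alpha_e}$ is $\sum_e w_e\alpha_e$. For a nonzero $p\in S$, $\operatorname{in}_w p$ is the sum of the terms of $p$ of minimal $w$-weight, and $\operatorname{in}_w I$ is the ideal generated by all $\operatorname{in}_w p$ with $p\in I\setminus\{0\}$. $\mathcal L(I)=\{w\in\mathbb{R}^E:\operatorname{in}_w I=I\}$ is a linear subspace. $\mathcal A(I)=(a_e)_{e\in E}$ is the point configuration in $\mathcal L(I)^*$ in which $a_e$ is the restriction to $\mathcal L(I)$ of the $e$-th coordinate functional. For a point configuration $A=(a_e)_{e\in E}$ in a real vector space $V$ and $u\in\mathbb{R}^E$, the regular subdivision $\operatorname{subd}_u A$ is the set of subconfigurations $(a_e)_{e\in E_f}$, for $f\in V^*$, where $E_f$ is the set of $e$ minimizing $f(a_e)+u_e$. These are called cells, and we write $a_e\in\Delta$ if $e$ is a label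 of $\Delta$. $\mathbb{C}[\Delta]=\mathbb{C}[x_e:a_e\in\Delta]\subset S$. *)

(* Defs.v *)
From HB Require Import structures.
From mathcomp Require Import all_boot all_order all_algebra.
From mathcomp Require Import finmap.
From mathcomp Require Import boolp classical_sets reals.
From mathcomp Require Import complex.
From mathcomp Require Import monalg.

Set Implicit Arguments.
Unset Strict Implicit.
Unset Printing Implicit Defensive.

Import Order.TTheory GRing.Theory Num.Theory.

Local Open Scope ring_scope.
Local Open Scope classical_set_scope.

(* The polynomial ring K[x_e : e in E]; a monomial m : {cmonom E} is a function
   giving the exponent m e of x_e. *)
Notation polyRing K E := {malg K[{cmonom E}]}.

Notation weight R E := {ffun E -> R^o}.

Section Ideals.
Context {A : comNzRingType}.

Definition is_ideal (I : set A) :=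
  [/\ I 0, (forall p q, I p -> I q -> I (p + q))
    & (forall c p, I p -> I (c * p))].

Definition ideal_gen (G : set A) : set A := smallest is_ideal G.

Lemma ideal_genP (G : set A) : is_ideal (ideal_gen G).
Proof.
split=> [J [[? _ _] _] //|p q Ip Iq J J'|c p Ip J J'].
  by have [[_ + _] _] := J'; apply; [apply: Ip|apply: Iq].
by have [[_ _ +] _] := J'; apply; apply: Ip.
Qed.

Lemma sub_ideal_gen (G : set A) : G `<=` ideal_gen G.
Proof. exact: sub_smallest. Qed.

Lemma ideal_gen_min (G I : set A) : is_ideal I -> G `<=` I -> ideal_gen G `<=` I.
Proof. by move=> II GI p; apply. Qed.

Lemma ideal_sum (I : set A) (T : Type) (r : seq T) (P : pred T) (F : T -> A) :
  is_ideal I -> (forall i, P i -> I (F i)) -> I (\sum_(i <- r | P i) F i).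
Proof. by move=> [I0 ID _] IF; apply: big_ind. Qed.

Lemma idealN (I : set A) p : is_ideal I -> I p -> I (- p).
Proof. by move=> [_ _ IM] Ip; rewrite -mulN1r; apply: IM. Qed.

End Ideals.

Section Polynomials.
Context {R : realType} {K : comNzRingType} {E : finType}.
Local Notation S := (polyRing K E).
Implicit Types (p : S) (I : set S) (w : weight R E) (m : {cmonom E}).

Definition var (e : E) : S := << 1 *g ucm e >>.

Definition irrelevant_ideal : set S := ideal_gen (range var).

(* The sum of the terms of p whose monomial satisfies P. *)
Definition terms (P : pred {cmonom E}) p : S :=
  [malg m in msupp p => if P m then p@_m else 0].

Definition homogeneous_ideal I :=
  forall p (d : nat), I p -> I (terms (fun m => mdeg m == d) p).

Definition wt w m : R := \sum_e w e *+ m e.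

Definition initial_form w p : S :=
  terms (fun m => all (fun m' => wt w m <= wt w m') (msupp p)) p.

Definition initial_ideal w I : set S :=
  ideal_gen [set initial_form w p | p in [set p | I p /\ p != 0]].

(* The subring K[x_e : e in D], as a subset of S. *)
Definition polys_in (D : {set E}) : set S :=
  [set p | forall m, m \in msupp p -> forall e, m e != 0%N -> e \in D].

End Polynomials.

Section Subdivision.
Context {R : realType} {E : finType}.

(* A subconfiguration of A : E -> V is represented by its set of labels. *)
Definition cell (V : lmodType R) (A : E -> V) (u : weight R E)
    (f : {linear V -> R^o}) : {set E} :=
  [set e | [forall e', (f (A e) + u e : R) <= f (A e') + u e']]%SET.

Definition subd (V : lmodType R) (u : weight R E) (A : E -> V) : set {set E} :=
  range (cell A u).

End Subdivision.

Section Lineality.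
Context {R : realType} {K : comNzRingType} {E : finType}.
Local Notation S := (polyRing K E).
Implicit Types (p : S) (I : set S) (w : weight R E) (m : {cmonom E}).

Lemma mcoeff_terms P p m : (terms P p)@_m = if P m then p@_m else 0.
Proof.
by rewrite mcoeffE; case: msuppP => // _; rewrite if_same.
Qed.

Lemma eq_in_terms P Q p :
  (forall m, m \in msupp p -> P m = Q m) -> terms P p = terms Q p.
Proof.
move=> PQ; apply/malgP => m; rewrite !mcoeff_terms.
by case: (msuppP p m) => [/PQ->//|_]; rewrite !if_same.
Qed.

Lemma termsB P p q : terms P (p - q) = terms P p - terms P q.
Proof.
apply/malgP => m; rewrite !(mcoeffB, mcoeff_terms).
by case: (P m); rewrite ?subr0.
Qed.

Lemma terms_terms P Q p : terms P (terms Q p) = terms (predI P Q) p.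
Proof.
by apply/malgP => m; rewrite !mcoeff_terms /=; case: (P m); case: (Q m).
Qed.

Definition wgraded I w := forall p (a : R), I p -> I (terms (fun m => wt w m == a) p).

Lemma seq_min (T : eqType) (f : T -> R) (s : seq T) : s != [::] ->
  exists2 x, x \in s & forall y, y \in s -> f x <= f y.
Proof.
elim: s => // x [|x' s] IH _.
  by exists x; rewrite ?mem_head // => ?; rewrite inE => /eqP->.
have [//|z zs zmin] := IH.
have [le|lt] := leP (f x) (f z).
  exists x; first exact: mem_head.
  by move=> y; rewrite inE => /predU1P[->//|/zmin]; apply: le_trans.
exists z; first by rewrite inE zs orbT.
by move=> y; rewrite inE => /predU1P[->|/zmin//]; apply: ltW.
Qed.

Lemma initial_formE w p : p != 0 ->
  exists2 m0, m0 \in msupp p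
            & initial_form w p = terms (fun m => wt w m == wt w m0) p.
Proof.
move=> p0.
have [|m0 m0p min0] := @seq_min _ (wt w) (msupp p).
  rewrite -msupp_eq0 in p0; apply: contra p0 => /eqP p0.
  by apply/eqP/fsetP => m; rewrite inE -[LHS]/(m \in (msupp p : seq _)) p0.
exists m0 => //; apply: eq_in_terms => m mp.
apply/allP/eqP => [/(_ _ m0p) le|-> x /min0 //].
by apply: le_anti; rewrite le min0.
Qed.

Lemma initial_ideal_ind I w (J : S -> Prop) : is_ideal I -> initial_ideal w I `<=` I ->
  J 0 ->
  (forall p, I p -> p != 0 -> I (initial_form w p) ->
    J (p - initial_form w p) -> J p) ->
  forall p, I p -> J p.
Proof.
move=> II iI J0 Jp p; have [n] := ubnP #|` msupp p|%fset.
elim: n p => // n IH p lepn Ip.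
have [->//|p0] := eqVneq p 0.
have Iip : I (initial_form w p).
  by apply: iI; apply: sub_ideal_gen; exists p.
apply: Jp => //; apply: IH; last first.
  by have [_ ID _] := II; apply: ID => //; apply: idealN.
have [m0 m0p ->] := initial_formE w p0.
rewrite -ltnS; apply: leq_trans lepn; rewrite ltnS; apply: fproper_ltn_card.
rewrite fproperE; apply/andP; split.
  apply/fsubsetP => m; rewrite -!mcoeff_neq0 mcoeffB mcoeff_terms.
  by case: ifP; rewrite ?subrr ?eqxx ?subr0.
apply/negP => /fsubsetP/(_ m0 m0p).
by rewrite -mcoeff_neq0 mcoeffB mcoeff_terms eqxx subrr eqxx.
Qed.

Lemma initial_ideal_wgraded I w : is_ideal I ->
  (initial_ideal w I = I) <-> wgraded I w.
Proof.
move=> II; split=> [eI p a Ip|gI].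
  have iI : initial_ideal w I `<=` I by rewrite eI.
  have {Ip} := Ip; move: p; apply: (initial_ideal_ind II iI).
    have [I0 _ _] := II.
    rewrite (_ : terms _ 0 = 0) //; apply/malgP => m.
    by rewrite mcoeff_terms mcoeff0 if_same.
  move=> p Ip p0 Iq; rewrite termsB => IB.
  set q := initial_form w p in Iq IB.
  have It : I (terms (fun m => wt w m == a) q).
    have [m0 m0p qE] := initial_formE w p0.
    rewrite /q qE terms_terms; have [am|am] := eqVneq a (wt w m0).
      rewrite (_ : terms _ p = q) //.
      by rewrite /q qE; apply: eq_in_terms => m _; rewrite /= am andbb.
    have [I0 _ _] := II.
    rewrite (_ : terms _ p = 0) //; apply/malgP => m.
    rewrite mcoeff_terms mcoeff0 /=; case: ifP => // /andP[/eqP-> /eqP am'].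
    by rewrite am' eqxx in am.
  by have [_ ID _] := II; rewrite -[X in I X](subrK (terms (fun m => wt w m == a) q)); apply: ID.
have iI : initial_ideal w I `<=` I.
  apply: ideal_gen_min => // _ [p [Ip p0] <-].
  by have [m0 _ ->] := initial_formE w p0; apply: gI.
apply/seteqP; split=> //; apply: (initial_ideal_ind II iI).
  by have [] := ideal_genP [set initial_form w p | p in [set p | I p /\ p != 0]].
move=> p Ip p0 _ Jp.
have [_ JD _] := ideal_genP [set initial_form w p | p in [set p | I p /\ p != 0]].
rewrite -[p](subrK (initial_form w p)); apply: JD => //.
by apply: sub_ideal_gen; exists p.
Qed.

Lemma wt0 m : wt (0 : weight R E) m = 0.
Proof. by rewrite /wt big1 // => e _; rewrite ffunE mul0rn. Qed.

Lemma wtD w w' m : wt (w + w') m = wt w m + wt w' m.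
Proof. by rewrite /wt -big_split; apply: eq_bigr => e _; rewrite ffunE mulrnDl. Qed.

Lemma wtZ (c : R) w m : wt (c *: w) m = c * wt w m.
Proof. by rewrite /wt mulr_sumr; apply: eq_bigr => e _; rewrite ffunE mulrnAr. Qed.

Lemma wgraded0 I : is_ideal I -> wgraded I 0.
Proof.
move=> [I0 _ _] p a Ip; have [a0|a0] := eqVneq 0 a.
  rewrite (_ : terms _ p = p) //; apply/malgP => m.
  by rewrite mcoeff_terms wt0 a0 eqxx.
rewrite (_ : terms _ p = 0) //; apply/malgP => m.
by rewrite mcoeff_terms wt0 (negbTE a0) mcoeff0.
Qed.

Lemma wgradedZ I (c : R) w : is_ideal I -> wgraded I w -> wgraded I (c *: w).
Proof.
move=> II Iw; have [->|c0] := eqVneq c 0; first by rewrite scale0r; apply: wgraded0.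
move=> p a Ip; rewrite (_ : terms _ p = terms (fun m => wt w m == c^-1 * a) p).
  exact: Iw.
by apply: eq_in_terms => m _; rewrite wtZ (can2_eq (mulKf c0) (mulVKf c0)).
Qed.

Lemma wgradedD I w w' : is_ideal I -> wgraded I w -> wgraded I w' ->
  wgraded I (w + w').
Proof.
move=> II Iw Iw' p a Ip.
rewrite (_ : terms _ p = \sum_(b <- undup [seq wt w m | m <- msupp p])
    terms (fun m => wt w' m == a - b) (terms (fun m => wt w m == b) p)).
  by apply: ideal_sum => // b _; apply/Iw'/Iw.
apply/malgP => m; rewrite mcoeff_terms raddf_sum /=.
case: (msuppP p m) => mp; last first.
  rewrite if_same big1 // => b _; rewrite !mcoeff_terms mcoeff_outdom //.
  by rewrite !if_same.
rewrite (bigD1_seq (wt w m)) ?undup_uniq ?mem_undup ?map_f //=.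
rewrite big1 => [|b nb].
  rewrite addr0 !mcoeff_terms eqxx wtD; congr (if _ then _ else _).
  by rewrite [RHS]eq_sym subr_eq eq_sym addrC.
by rewrite !mcoeff_terms [wt w m == b]eq_sym (negbTE nb) if_same.
Qed.

Lemma closed_vspace (V : vectType R) (P : set V) : P 0 ->
  (forall (c : R) v v', P v -> P v' -> P (c *: v + v')) ->
  exists U : {vspace V}, forall v, v \in U <-> P v.
Proof.
move=> P0 PD.
pose Q n := `[< exists2 U : {vspace V}, \dim U = n & forall v, v \in U -> P v >].
have exQ : exists n, Q n.
  exists 0%N; apply/asboolP; exists 0%VS; first exact: dimv0.
  by move=> v; rewrite memv0 => /eqP->.
have ubQ n : Q n -> (n <= dim V)%N.
  by move=> /asboolP[U <- _]; rewrite -dimvf dimvS ?subvf.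
case: (ex_maxnP exQ ubQ) => n /asboolP[U dU UP] maxn.
exists U => v; split=> [|Pv]; first exact: UP.
have PUv x : x \in (U + <[v]>)%VS -> P x.
  by case/memv_addP => y /UP Py [_ /vlineP[c ->] ->]; rewrite addrC; apply: PD.
have /maxn : Q (\dim (U + <[v]>)) by apply/asboolP; exists (U + <[v]>)%VS.
rewrite -dU => le; have /eqP -> : U == (U + <[v]>)%VS by rewrite eqEdim addvSl.
by rewrite (subvP (addvSr _ _)) ?memv_line.
Qed.

Lemma lineality_vspace I : is_ideal I ->
  exists L : {vspace weight R E}, forall w, w \in L <-> initial_ideal w I = I.
Proof.
move=> II; have [||L LE] := @closed_vspace _ (wgraded I).
- exact: wgraded0.
- by move=> c w w' Iw Iw'; apply: wgradedD => //; apply: wgradedZ.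
by exists L => w; rewrite LE initial_ideal_wgraded.
Qed.

(* L(I), as a subspace of R^E; by mem_lineality below, the default value 0 is
   never taken when I is an ideal. *)
Definition lineality I : {vspace weight R E} :=
  xget 0%VS [set L : {vspace weight R E} | forall w, w \in L <-> initial_ideal w I = I].

Lemma mem_lineality I w : is_ideal I ->
  w \in lineality I <-> initial_ideal w I = I.
Proof. by move=> /lineality_vspace/xgetPex; apply. Qed.

Definition lineality_dual I := 'Hom(subvs_of (lineality I), R^o).

Definition coordinate (e : E) (I : set S) (l : subvs_of (lineality I)) : R^o :=
  vsval l e.

Fact coordinate_is_linear e I : linear (@coordinate e I).
Proof. by move=> c l l'; rewrite /coordinate linearP !ffunE. Qed.

HB.instance Definition _ e I :=
  GRing.isLinear.Build R (subvs_of (lineality I)) R^o *:%R (@coordinate e I)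
    (@coordinate_is_linear e I).

Definition config I (e : E) : lineality_dual I := linfun (@coordinate e I).

Lemma configE I e (l : subvs_of (lineality I)) : config I e l = vsval l e.
Proof. exact: lfunE. Qed.

Definition tilde_ideal I (D : {set E}) : set S :=
  ideal_gen ((I `&` polys_in D) `|` [set var e | e in [set e | e \notin D]]).

Definition intersection_ideal w I : set S :=
  \bigcap_(D in subd (- w) (config I)) tilde_ideal I D.

End Lineality.

(* Main.v *)
(** A cell of [subd (- w) (config I)] is cut out by some [l] in the lineality
    space: it is the set of labels minimizing [l e - w e].  Since [I] is
    homogeneous, constant weights are in the lineality space too, so [l] can be
    shifted to make this minimum 0; then [w <= l], and the cell [D] is the set
    where [w] and [l] agree.  As [I] is graded by [l], it contains every
    [l]-homogeneous component [q] of [p].  The part of [q] of minimal [w]-weight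
    [c] for [p] is either all of [q], which then only involves the variables in
    [D] (when [q] has [l]-weight [c]), or a sum of terms each involving a
    variable outside [D]. *)
Require Import Defs.
From HB Require Import structures.
From mathcomp Require Import all_boot all_order all_algebra.
From mathcomp Require Import finmap.
From mathcomp Require Import boolp classical_sets reals.
From mathcomp Require Import complex.
From mathcomp Require Import monalg.

Import Order.TTheory GRing.Theory Num.Theory.

Local Open Scope ring_scope.
Local Open Scope classical_set_scope.

Section Terms.
Context {R : realType} {K : comNzRingType} {E : finType}.
Implicit Types (p : polyRing K E) (I : set (polyRing K E)) (w l : weight R E).
Implicit Types (m : {cmonom E}) (D : {set E}) (P : pred {cmonom E}).

Lemma terms_eq0 P p : (forall m, m \in msupp p -> ~~ P m) -> terms P p = 0.
Proof.
move=> Pp; apply/malgP => m; rewrite mcoeff_terms mcoeff0.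
by case: (msuppP p m) => [/Pp/negbTE->//|_]; rewrite if_same.
Qed.

Lemma terms_id P p : (forall m, m \in msupp p -> P m) -> terms P p = p.
Proof.
move=> Pp; apply/malgP => m; rewrite mcoeff_terms.
by case: (msuppP p m) => [/Pp->//|_]; rewrite if_same.
Qed.

Lemma msupp_terms P p m : (m \in msupp (terms P p)) = P m && (m \in msupp p).
Proof. by rewrite -!mcoeff_neq0 mcoeff_terms; case: (P m); rewrite ?eqxx. Qed.

(** A monomial [m] of [p] survives only in the summand with [b = f m], and [undup] makes this
    summand occur once. *)
Lemma sum_terms (T : eqType) (f : {cmonom E} -> T) p :
  p = \sum_(b <- undup [seq f m | m <- msupp p]) terms (fun m => f m == b) p.
Proof.
apply/malgP => m; rewrite raddf_sum /=.
case: (msuppP p m) => mp; last first.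
  by rewrite big1 // => b _; rewrite mcoeff_terms mcoeff_outdom // if_same.
rewrite (bigD1_seq (f m)) ?undup_uniq ?mem_undup ?map_f //=.
rewrite mcoeff_terms eqxx big1 ?addr0 // => b nb.
by rewrite mcoeff_terms eq_sym (negbTE nb).
Qed.

Lemma terms_sum P (T : Type) (r : seq T) (F : T -> polyRing K E) :
  terms P (\sum_(b <- r) F b) = \sum_(b <- r) terms P (F b).
Proof.
apply/malgP => m; rewrite mcoeff_terms !raddf_sum /=.
case: ifP => Pm; last by rewrite big1 // => b _; rewrite mcoeff_terms Pm.
by apply: eq_bigr => b _; rewrite mcoeff_terms Pm.
Qed.

Lemma dvd_var (c : K) m e : m e != 0%N ->
  exists q, << c *g m >> = q * var e :> polyRing K E.
Proof.
move=> me; exists << c *g divcm m (ucm e) >>.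
rewrite /var [RHS]malgM_def fgmulUU mulr1.
suff {1}-> : m = mulcm (divcm m (ucm e)) (ucm e) by [].
apply/eqP/cmP => i; rewrite mulcmE divcmE ucmE subnK //.
by have [<-|] := eqVneq e i; rewrite ?lt0n.
Qed.

Lemma mdeg_sum m : mdeg m = (\sum_e m e)%N.
Proof.
rewrite mdegE big_uniq ?fset_uniq //= [RHS](bigID (fun e => e \in finsupp m)) /=.
by rewrite [X in (_ + X)%N]big1 ?addn0 // => e; rewrite -cmE_eq0 => /eqP.
Qed.

Lemma wt_const (c : R) m : wt ([ffun=> c] : weight R E) m = c *+ mdeg m.
Proof. by rewrite mdeg_sum -sumrMnr; apply: eq_bigr => e _; rewrite ffunE. Qed.

(** Scaling reduces to the constant weight 1, for which the weight of a monomial is its degree. A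
    component at a real number [a] that is not a natural number is 0. *)
Lemma wgraded_const I (c : R) : is_ideal I -> homogeneous_ideal I ->
  wgraded I ([ffun=> c] : weight R E).
Proof.
move=> II hI; rewrite (_ : [ffun=> c] = c *: [ffun=> 1] :> weight R E); last first.
  by apply/ffunP => e; rewrite !ffunE; apply/esym/mulr1.
apply: wgradedZ => // p a Ip; have [[d <-]|noa] := pselect (exists d : nat, d%:R = a).
  rewrite (@eq_in_terms _ _ _ (fun m => mdeg m == d)); first exact: hI.
  by move=> m _; rewrite wt_const eqr_nat.
have [I0 _ _] := II; rewrite terms_eq0 // => m _; rewrite wt_const.
by apply/eqP => ma; apply: noa; exists (mdeg m).
Qed.

Lemma ler_wt w l m : (forall e, w e <= l e :> R) -> wt w m <= wt l m.
Proof. by move=> wl; apply: ler_sum => e _; rewrite lerMn2r wl orbT. Qed.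

(** The difference of the two weights is a sum of nonnegative terms [(l e - w e) *+ m e], so it
    vanishes only if every term does. *)
Lemma eq_wtP w l m : (forall e, w e <= l e :> R) ->
  wt w m = wt l m <-> (forall e, m e != 0%N -> w e = l e).
Proof.
move=> wl; split=> [eqwl e me|wlm]; last first.
  apply: eq_bigr => e _; have [->|/wlm->//] := eqVneq (m e) 0%N.
  by rewrite !mulr0n.
have /eqP : wt l m - wt w m = 0 by rewrite eqwl subrr.
rewrite /wt -sumrB psumr_eq0 => [/allP/(_ e (mem_index_enum e))/=|i _]; last first.
  by rewrite subr_ge0 lerMn2r wl orbT.
by rewrite -mulrnBl mulrn_eq0 (negbTE me) subr_eq0 => /eqP.
Qed.

(** Each term of [p] is a multiple of a generator [var e] with [e] outside [D]. *)
Lemma tilde_ideal_terms I D p :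
  (forall m, m \in msupp p -> exists2 e, m e != 0%N & e \notin D) ->
  tilde_ideal I D p.
Proof.
move=> pD; have JJ := ideal_genP ((I `&` polys_in D) `|`
  [set var e | e in [set e | e \notin D]]).
rewrite (monalgE p) big_seq; apply: ideal_sum => // m /pD[e me eD].
have [q ->] := dvd_var p@_m m e me; have [_ _ JM] := JJ.
have Je : tilde_ideal I D (var e) by apply: sub_ideal_gen; right; exists e.
exact: JM.
Qed.

Lemma initial_form_tilde I w l D p : is_ideal I -> wgraded I l ->
  (forall e, w e <= l e :> R) -> (forall e, (e \in D) = (w e == l e :> R)) ->
  I p -> p != 0 -> tilde_ideal I D (initial_form w p).
Proof.
move=> II Il wl DE Ip p0.
have [m0 m0p m0min] : exists2 m0, m0 \in msupp p &
    forall m, m \in msupp p -> wt w m0 <= wt w m.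
  apply: seq_min; move: p0; rewrite -msupp_eq0; apply: contra => /eqP p0.
  by apply/eqP/fsetP => m; rewrite inE -[LHS]/(m \in (msupp p : seq _)) p0.
set c := wt w m0 in m0min.
have -> : initial_form w p = terms (fun m => wt w m == c) p.
  apply: eq_in_terms => m mp; apply/allP/eqP => [/(_ _ m0p) le|-> //].
  by apply: le_anti; rewrite le m0min.
rewrite [X in terms _ X](sum_terms _ (wt l)) terms_sum.
apply: ideal_sum => [|b _]; first exact: ideal_genP.
have inD m : wt w m = wt l m <-> (forall e, m e != 0%N -> e \in D).
  by rewrite eq_wtP //; split=> H e /H; rewrite DE => /eqP.
(* If [b != c], a monomial of [w]-weight [c] and [l]-weight [b] involves a variable outside [D],
   since otherwise [inD] would equate the two weights. *)
have [bc|bc] := eqVneq b c; last first.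
  apply: tilde_ideal_terms => m.
  rewrite !msupp_terms => /and3P[/eqP mc /eqP mb _].
  apply: contrapT => nD; move/eqP: bc; apply; rewrite -mb -mc.
  apply/esym/inD => e me; apply: contrapT => /negP eD; apply: nD.
  by exists e.
(* Now [c <= wt w m <= wt l m = b = c], so cutting at [w]-weight [c] leaves the whole [l]-component,
   which lies in [I]. *)
have wtc m : m \in msupp (terms (fun m => wt l m == b) p) ->
    wt w m = c /\ wt w m = wt l m.
  rewrite msupp_terms => /andP[/eqP mb /m0min cm].
  have eq : wt w m = wt l m by apply: le_anti; rewrite ler_wt // mb bc cm.
  by rewrite eq mb bc.
rewrite terms_id => [|m /wtc[-> //]].
apply: sub_ideal_gen; left; split; first exact: Il.
by move=> m /wtc[_ /inD].
Qed.

End Terms.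

(** Reflexivity of a finite-dimensional space: the coordinates of [v] in a basis are the values of
    [f] on the dual basis [co]. It turns the functional cutting out a cell into a weight in the
    lineality space. *)
Lemma hom_dual (F : fieldType) (V : vectType F)
    (f : {linear 'Hom(V, F^o) -> F^o}) :
  exists v : V, forall phi : 'Hom(V, F^o), f phi = phi v.
Proof.
pose b := vbasis {:V}.
pose co i : 'Hom(V, F^o) := linfun (coord b i : V -> F^o).
exists (\sum_(i < \dim {:V}) f (co i) *: b`_i) => phi.
have {1}-> : phi = \sum_(i < \dim {:V}) phi b`_i *: co i.
  apply/lfunP => u; rewrite sum_lfunE {1}(coord_vbasis (memvf u)) linear_sum.
  apply: eq_bigr => i _; rewrite scale_lfunE lfunE linearZ /=.
  exact: mulrC.
rewrite !linear_sum; apply: eq_bigr => i _; rewrite !linearZ /=.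
exact: mulrC.
Qed.

Theorem theorem3p10 (R : realType) (E : finType)
    (I : set (polyRing (complex R) E)) (w : weight R E) :
  is_ideal I -> homogeneous_ideal I -> ~ (irrelevant_ideal `<=` I) ->
  initial_ideal w I `<=` intersection_ideal w I.
Proof.
move=> II hI _ q wq _ [f _ <-]; set D := cell _ _ _.
move: q wq; apply: ideal_gen_min; first exact: ideal_genP.
move=> _ [p [Ip p0] <-].
have [v fv] := hom_dual _ _ f.
have {}fv e : f (config I e) = vsval v e by rewrite fv configE.
have DE e : (e \in D) = [forall e', vsval v e - w e <= vsval v e' - w e' :> R].
  by rewrite inE; apply: eq_forallb => e'; rewrite !fv !ffunE.
have Iv : wgraded I (vsval v).
  by rewrite -initial_ideal_wgraded // -mem_lineality // subvsP.
(* [M] is the minimum that defines the cell. If [E] is empty, both conditions are vacuous and 0 is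
   an arbitrary choice. *)
have [M Mmin MD] : exists2 M : R, forall e, M <= vsval v e - w e &
    forall e, (e \in D) = (vsval v e - w e == M).
  have [e0|noE] := pickP (fun e : E => true); last first.
    by exists 0 => e; have := noE e.
  have [|e _ emin] := @seq_min _ _ (fun e => vsval v e - w e : R) (enum E).
    by apply/eqP => E0; have := mem_enum E e0; rewrite E0.
  have {}emin e' : vsval v e - w e <= vsval v e' - w e' :> R.
    by apply: emin; rewrite mem_enum.
  exists (vsval v e - w e) => // e'; rewrite DE.
  apply/forallP/eqP => [le|-> //].
  by apply: le_anti; rewrite le emin.
(* Subtracting [M] keeps [I] graded, as [I] is homogeneous, and makes [D] the set where the shifted
   weight meets its lower bound [w]. *)
apply: (initial_form_tilde _ _ (vsval v + [ffun=> - M])) => // [|e|e].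
- by apply: wgradedD => //; apply: wgraded_const.
- by rewrite !ffunE; have := Mmin e; rewrite lerBrDl lerBrDr.
- by rewrite MD !ffunE -[RHS]eq_sym !subr_eq addrC.
Qed.
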